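(* Let $Y$ be a topological vector space and let $A$ be a closed proper subset of $Y$. Let $k\in Y\setminus\{0\}$. The following conditions are equivalent: (a) $k\in-0^+A$. (b) $A=H-C$ for some proper subset $H$ of $Y$ and some convex cone $C\subset Y$ with $k\in C$. (c) $A=A-C$ for some non-trivial closed convex cone $C\subset Y$ with $k\in C$. (d) $A=A-C$ for some non-trivial cone $C\subset Y$ with $k\in C$.
   Context: Vector spaces are real. ''Proper subset of $Y$'' means nonempty and different from $Y$. A set $C$ is a cone if $\lambda c\in C$ for all $\lambda\ge0$, $c\in C$; it is non-trivial if $C\neq\{0\}$ and $C\neq Y$. $0^+A=\{u\in Y\mid a+tu\in A\ \forall a\in A,\ \forall t\ge0\}$ is the recession cone. $H-C=\{h-c\mid h\in H,c\in C\}$. *)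

(* Defs.v *)
From mathcomp Require Import all_boot all_order all_algebra.
From mathcomp Require Import boolp classical_sets reals topology convex tvs.

Set Implicit Arguments.
Unset Strict Implicit.
Unset Printing Implicit Defensive.

Import GRing.Theory Num.Theory.

Local Open Scope classical_set_scope.
Local Open Scope ring_scope.

Definition proper_subset (T : Type) (A : set T) : Prop :=
  A !=set0 /\ A <> setT.

(* The empty set is vacuously a cone; any nonempty cone contains 0. *)
Definition cone (R : realType) (Y : lmodType R) (C : set Y) : Prop :=
  forall (l : R) (c : Y), 0 <= l -> C c -> C (l *: c).

Definition nontrivial (R : realType) (Y : lmodType R) (C : set Y) : Prop :=
  C <> [set 0] /\ C <> setT.

Definition recession_cone (R : realType) (Y : lmodType R) (A : set Y) : set Y :=
  [set u | forall (a : Y) (t : R), A a -> 0 <= t -> A (a + t *: u)].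

(* The elementwise difference H - C, not the set-theoretic one. *)
Definition algdiff (R : realType) (Y : lmodType R) (H C : set Y) : set Y :=
  [set h - c | h in H & c in C].

(* Main.v *)
Require Import Defs.
From mathcomp Require Import all_boot all_order all_algebra.
From mathcomp Require Import boolp classical_sets reals topology convex tvs.
From mathcomp Require Import interval_inference.

(** Everything turns on the single set [-0^+A], the directions along which one
    may move backwards from any point of [A] without leaving [A].

    For arbitrary [A] it is a convex cone with [A = A - (-0^+A)], and it is
    closed when [A] is, being the intersection over [a] in [A] and [t >= 0] of
    the preimages of [A] under the continuous maps [c |-> a - t c].  It is not
    the whole space, since otherwise [A], being nonempty, would be the whole
    space; so as soon as it contains some [k != 0] it witnesses (b) (with
    [H = A]), (c) and (d) all at once.

    Conversely [-0^+A] is the largest cone that can occur in these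
    decompositions.  If [A = A - C] with [C] a cone, then [a - t c] is in [A]
    for [a] in [A], [c] in [C] and [t >= 0], because [t c] is in [C].  If only
    [A = H - C], a point of [A] already has the form [h - d] with [d] in [C],
    and subtracting [t c] from it stays in [H - C] because a convex cone is
    closed under addition ([convex_cone_add]).  Either way [C] is contained in
    [-0^+A], so that [k] in [C] gives (a). *)

Set Implicit Arguments.
Unset Strict Implicit.
Unset Printing Implicit Defensive.

Import GRing.Theory Num.Theory.

Local Open Scope classical_set_scope.
Local Open Scope ring_scope.

Section Algebra.
Context (R : realType) (Y : lmodType R).
Implicit Types (A H C : set Y) (c : Y).

Lemma opp_recessionP A c :
  (-%R @` recession_cone A) c <->
  forall (a : Y) (t : R), A a -> 0 <= t -> A (a - t *: c).
Proof.
split=> [[u ru <-] a t Aa t0|hc].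
  by rewrite scalerN opprK; exact: ru.
by exists (- c); rewrite ?opprK// => a t Aa t0; rewrite scalerN; exact: hc.
Qed.

Lemma opp_recession_cone A : cone (-%R @` recession_cone A).
Proof.
move=> l c l0 /opp_recessionP hc; apply/opp_recessionP => a t Aa t0.
by rewrite scalerA; apply: hc => //; rewrite mulr_ge0.
Qed.

(** The move [t (l x + (1 - l) y)] is performed as two successive moves, along
    [x] and then along [y], each of which stays in [A]. *)
Lemma opp_recession_convex A : convex_set (-%R @` recession_cone A).
Proof.
move=> x y l; rewrite !in_setE => /opp_recessionP hx /opp_recessionP hy.
apply/opp_recessionP => a t Aa t0.
rewrite -[conv _ _ _]/(l%:num *: (x : Y) + (1 - l%:num) *: (y : Y)).
rewrite scalerDr !scalerA opprD addrA.
by apply: hy; [apply: hx|]; rewrite // mulr_ge0// subr_ge0.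
Qed.

Lemma algdiff_opp_recession A : A = algdiff A (-%R @` recession_cone A).
Proof.
apply/seteqP; split=> [a Aa|_ [a Aa [c /opp_recessionP hc <-]]].
  exists a => //; exists 0; last by rewrite subr0.
  by apply/opp_recessionP => b t Ab _; rewrite scaler0 subr0.
by rewrite -[c]scale1r; apply: hc.
Qed.

Lemma opp_recession_nontrivial A k : proper_subset A -> k != 0 ->
  (-%R @` recession_cone A) k -> nontrivial (-%R @` recession_cone A).
Proof.
move=> [[a Aa] AT] /eqP k0 rk; split=> E; first by move: rk; rewrite E.
apply: AT; apply/seteqP; split=> // y _.
have /opp_recessionP/(_ a 1 Aa ler01) : (-%R @` recession_cone A) (a - y).
  by rewrite E.
by rewrite scale1r subKr.
Qed.

(** The sum is twice the midpoint. *)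
Lemma convex_cone_add C x y :
  cone C -> convex_set C -> C x -> C y -> C (x + y).
Proof.
move=> coneC convC Cx Cy.
have half01 : (0 <= 2^-1 :> R) && (2^-1 <= 1 :> R).
  by rewrite invr_ge0 ler0n invf_le1 ?ltr0n// ler1n.
have := convC x y (Itv01 (proj1 (andP half01)) (proj2 (andP half01))).
rewrite !in_setE => /(_ Cx Cy).
rewrite -[conv _ _ _]/(2^-1 *: x + (1 - 2^-1) *: y) => Cmid.
have -> : x + y = 2 *: (2^-1 *: x + (1 - 2^-1) *: y).
  have n2 : 2 != 0 :> R by rewrite pnatr_eq0.
  by rewrite scalerDr !scalerA mulrBr divff// mulr1 -addrA subrr addr0 !scale1r.
by apply: coneC => //; rewrite ler0n.
Qed.

Lemma convex_cone_sub_opp_recession A H C : cone C -> convex_set C ->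
  A = algdiff H C -> C `<=` -%R @` recession_cone A.
Proof.
move=> coneC convC -> c Cc; apply/opp_recessionP => _ t [h Hh [d Cd <-]] t0.
exists h => //; exists (d + t *: c); last by rewrite opprD addrA.
by apply: convex_cone_add => //; exact: coneC.
Qed.

Lemma cone_sub_opp_recession A C : cone C ->
  A = algdiff A C -> C `<=` -%R @` recession_cone A.
Proof.
move=> coneC AE c Cc; apply/opp_recessionP => a t Aa t0.
by rewrite AE; exists a => //; exists (t *: c) => //; exact: coneC.
Qed.

End Algebra.

Lemma opp_recession_closed (R : realType) (Y : topologicalLmodType R)
  (A : set Y) : closed A -> closed (-%R @` recession_cone A).
Proof.
move=> clA.
have -> : -%R @` recession_cone A =
    \bigcap_(p in [set p : Y * R | A p.1 /\ 0 <= p.2])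
      ((fun c => p.1 - p.2 *: c) @^-1` A).
  apply/seteqP; split=> c.
    by move=> /opp_recessionP hc [a t] [/= Aa t0]; exact: hc.
  by move=> hc; apply/opp_recessionP => a t Aa t0; exact: (hc (a, t)).
apply: closed_bigI => -[a t] _ /=; apply: preimage_closed => // c _.
apply: (@continuous_comp _ (Y * Y)%type _ (fun c => (a, t *: c))
  (fun x : Y * Y => x.1 - x.2)); last exact: sub_continuous.
apply: cvg_pair; first exact: cvg_cst.
apply: (@continuous_comp Y (R^o * Y)%type Y (fun c => (t, c))
  (fun x => x.1 *: x.2)); last exact: scale_continuous.
by apply: (@cvg_pair _ _ _ _ (nbhs (t : R^o))); [exact: cvg_cst|exact: cvg_id].
Qed.

Theorem proposition2 (R : realType) (Y : topologicalLmodType R) (A : set Y)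
    (A_closed : closed A) (A_proper : proper_subset A)
    (k : Y) (k_neq0 : k != 0) :
  [<-> (-%R @` recession_cone A) k;
       exists H C : set Y,
         [/\ proper_subset H, cone C, convex_set C, C k & A = algdiff H C];
       exists C : set Y,
         [/\ nontrivial C, closed C, cone C, convex_set C & C k]
         /\ A = algdiff A C;
       exists C : set Y,
         [/\ nontrivial C, cone C, C k & A = algdiff A C]].
Proof.
tfae.
- move=> rk; exists A, (-%R @` recession_cone A); split=> //.
  + exact: opp_recession_cone.
  + exact: opp_recession_convex.
  + exact: algdiff_opp_recession.
- move=> [H [C [_ coneC convC Ck AE]]].
  have rk := convex_cone_sub_opp_recession coneC convC AE Ck.
  (* The given C need not be closed, so it is enlarged to the whole of -0^+A. *)
  exists (-%R @` recession_cone A); split; last exact: algdiff_opp_recession.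
  split=> //.
  + exact: opp_recession_nontrivial rk.
  + exact: opp_recession_closed.
  + exact: opp_recession_cone.
  + exact: opp_recession_convex.
- by move=> [C [[ntC _ coneC _ Ck] AE]]; exists C.
- by move=> [C [_ coneC Ck AE]]; exact: cone_sub_opp_recession AE _ Ck.
Qed.
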